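(* Let $d\ge 4$. Let $A\in M_d(\mathbb{C})$ be the diagonal matrix $A=\operatorname{diag}(1,2,\ldots,d)$, and let $B\in M_d(\mathbb{C})$ be the matrix whose $(i,j)$ entry is $1$ if $i<j$, $-1$ if $i>j$, and $0$ if $i=j$. Then the $2d\times 2d$ matrix $$T=\begin{pmatrix} A & B\\ 0 & A\end{pmatrix}$$ is skew-Hamiltonian and irreducible.
   Context: A $2d\times 2d$ complex matrix is skew-Hamiltonian if it has the form $\begin{pmatrix} A & B\\ D & A^t\end{pmatrix}$ with $A,B,D\in M_d(\mathbb{C})$, $B^t=-B$, $D^t=-D$ ($^t$ is the non-conjugated transpose). A matrix $T\in M_n(\mathbb{C})$ is irreducible if it is not unitarily equivalent to a direct sum $A_1\oplus A_2$ with $A_1\in M_k(\mathbb{C})$, $A_2\in M_{n-k}(\mathbb{C})$ for some $1\le k<n$; equivalently, the only normal matrices commuting with $T$ are scalar multiples of the identity. (Unitary equivalence: $X\cong Y$ if $X=UYU^*$ with $U$ unitary.) *)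

(* Defs.v *)
From mathcomp Require Import all_boot all_order all_algebra.
From mathcomp Require Import spectral sesquilinear reals complex.

Set Implicit Arguments.
Unset Strict Implicit.
Unset Printing Implicit Defensive.

Import Order.TTheory GRing.Theory Num.Theory.

Local Open Scope ring_scope.
Local Open Scope sesquilinear_scope.

Definition skew_hamiltonian (C : numClosedFieldType) (d : nat)
    (M : 'M[C]_(d + d)) : Prop :=
  exists A B D : 'M[C]_d,
    [/\ M = block_mx A B D A^T, B^T = - B & D^T = - D].

Definition unitarily_equivalent (C : numClosedFieldType) (n : nat)
    (X Y : 'M[C]_n) : Prop :=
  exists2 U : 'M[C]_n, U \is unitarymx & X = U *m Y *m U^t*.

(* The direct sum lives in 'M_(k + (n - k)), hence the cast to 'M_n. *)
Definition direct_sum_mx (C : numClosedFieldType) (n k : nat) (lekn : (k <= n)%N)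
    (A1 : 'M[C]_k) (A2 : 'M[C]_(n - k)) : 'M[C]_n :=
  castmx (subnKC lekn, subnKC lekn) (block_mx A1 0 0 A2).

Definition irreducible_mx (C : numClosedFieldType) (n : nat)
    (T : 'M[C]_n) : Prop :=
  ~ exists (k : nat) (k_ge1 : (1 <= k)%N) (ltkn : (k < n)%N)
           (A1 : 'M[C]_k) (A2 : 'M[C]_(n - k)),
      unitarily_equivalent T (direct_sum_mx (ltnW ltkn) A1 A2).

(* Indices in 'I_d start at 0: this is diag(1, 2, ..., d). *)
Definition diagA (C : numClosedFieldType) (d : nat) : 'M[C]_d :=
  diag_mx (\row_(i < d) i.+1%:R).

Definition signB (C : numClosedFieldType) (d : nat) : 'M[C]_d :=
  \matrix_(i < d, j < d)
    if (i < j)%N then 1 else if (j < i)%N then -1 else 0.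

(* Main.v *)
(** A reducing decomposition of [T] yields a non-scalar Hermitian [P] commuting
    with [T].  Write [P] in [d] x [d] blocks [X], [Y], [Y^*], [Z].  The lower
    left block of [TP = PT] makes [Y] diagonal, as [A] has distinct diagonal
    entries; the diagonal blocks together with [X^* = X] then make [Y] equal to
    a scalar [w] (using [d >= 3]) and give [X i j = w / |i - j|],
    [Z i j = - w / |i - j|] off the diagonal.  The upper right block becomes
    [BZ = XB]; the combination (1,3) + (2,4) - (1,4) - (2,3) of its entries
    eliminates the diagonals of [X] and [Z] and reads [2 w (1 - 1/3) = 0].
    Hence [w = 0], and [BZ = XB] forces [X = Z] to be scalar. *)
Require Import Defs.
From mathcomp Require Import all_boot all_order all_algebra.
From mathcomp Require Import spectral sesquilinear reals complex.
From mathcomp Require Import ring zify.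

Import Order.TTheory GRing.Theory Num.Theory.

Local Open Scope ring_scope.

Section Blocks.
Set Implicit Arguments.
Unset Strict Implicit.
Unset Printing Implicit Defensive.
Local Open Scope sesquilinear_scope.
Variables (C : numClosedFieldType).

Lemma signB_tr d : (signB C d)^T = - signB C d.
Proof.
apply/matrixP => i j; rewrite !mxE.
by case: (ltngtP i j) => _; rewrite ?opprK ?oppr0.
Qed.

Lemma signB_anti d (i j : 'I_d) : signB C d j i = - signB C d i j.
Proof. by have /matrixP/(_ i j) := signB_tr d; rewrite !mxE. Qed.

Lemma signB_lt d (i j : 'I_d) : (i < j)%N -> signB C d i j = 1.
Proof. by rewrite mxE => ->. Qed.

Lemma signB_neq0 d (i j : 'I_d) : i != j -> signB C d i j != 0.
Proof.
rewrite mxE -val_eqE /=.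
by case: (ltngtP i j) => // _ _; rewrite ?oppr_eq0 oner_eq0.
Qed.

(** The sign of [k - i] changes only where [k] crosses the two consecutive indices, by one at each.
    This telescoping later collapses sums over [k] to two terms. *)
Lemma signB_row_step d (i i' k : 'I_d) : i' = i.+1 :> nat ->
  signB C d i k - signB C d i' k = (k == i)%:R + (k == i')%:R.
Proof.
move=> ii'; rewrite !mxE -!val_eqE /= ii'.
case: (ltngtP i k) => ik.
- case: (ltngtP i.+1 k) => ik'; try lia; rewrite ?subrr ?addr0 ?add0r ?subr0 //.
- case: (ltngtP i.+1 k) => ik'; try lia; rewrite ?subrr ?addr0 //.
- case: (ltngtP i.+1 k) => ik'; try lia; rewrite sub0r opprK addr0 //.
Qed.

Lemma sum_pick2 d (i j : 'I_d) (F : 'I_d -> C) :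
  \sum_k ((k == i)%:R + (k == j)%:R) * F k = F i + F j.
Proof.
under eq_bigr do rewrite mulrDl.
rewrite big_split /=; congr (_ + _).
  rewrite (bigD1 i) //= eqxx mul1r big1 ?addr0 // => k /negbTE->.
  by rewrite mul0r.
rewrite (bigD1 j) //= eqxx mul1r big1 ?addr0 // => k /negbTE->.
by rewrite mul0r.
Qed.

(** The entry [(i, j)] of the commutation relation is [W i j] times the difference of two diagonal
    entries of [diagA], nonzero in characteristic zero when [i != j]. *)
Lemma diagA_comm_diag d (W : 'M[C]_d) : diagA C d *m W = W *m diagA C d ->
  forall i j, i != j -> W i j = 0.
Proof.
move=> cAW i j neq_ij; have /matrixP/(_ i j) := cAW.
rewrite mul_diag_mx mul_mx_diag !mxE mulrC => /eqP.
rewrite -subr_eq0 -mulrBr mulf_eq0 subr_eq0 eqr_nat eqSS => /orP[/eqP //|].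
by rewrite (inj_eq val_inj) (negbTE neq_ij).
Qed.

Lemma mulmx_diag_entryr d (B W : 'M[C]_d) :
  (forall i j, i != j -> W i j = 0) -> forall i j, (B *m W) i j = B i j * W j j.
Proof.
move=> W0 i j; rewrite mxE (bigD1 j) //= big1 ?addr0 // => k kj.
by rewrite W0 // mulr0.
Qed.

Lemma mulmx_diag_entryl d (B W : 'M[C]_d) :
  (forall i j, i != j -> W i j = 0) -> forall i j, (W *m B) i j = W i i * B i j.
Proof.
move=> W0 i j; rewrite mxE (bigD1 i) //= big1 ?addr0 // => k ki.
by rewrite W0 ?mul0r // eq_sym.
Qed.

Lemma third_ord d (i j : 'I_d) : (3 <= d)%N -> exists k, (k != i) && (k != j).
Proof.
move=> hd; have : (0 < #|~: [set i; j]|)%N.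
  have := cardsC [set i; j]; rewrite card_ord cards2.
  by case: (_ != _) => /=; lia.
by case/card_gt0P => k; rewrite !inE negb_or; exists k.
Qed.

(** * Block equations of a Hermitian matrix commuting with [T] *)

Section HermitianCommutant.
Variables (d : nat) (hd : (4 <= d)%N) (X Y W Z : 'M[C]_d).
Let A := diagA C d.
Let B := signB C d.
(** The lower left block [W] is the adjoint of [Y]; [e11] to [e22] are the four blocks of the
    commutation relation. *)
Hypotheses (hX : forall i j, X i j = (X j i)^*)
  (hYW : forall i j, Y i j = (W j i)^*).
Hypotheses (e11 : A *m X + B *m W = X *m A)
  (e12 : A *m Y + B *m Z = X *m B + Y *m A)
  (e21 : A *m W = W *m A)
  (e22 : A *m Z = W *m B + Z *m A).

Let Wdiag : forall i j, i != j -> W i j = 0 := diagA_comm_diag e21.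

(** Difference of two diagonal entries of [A], whose shifts by one cancel. *)
Let gap (i j : 'I_d) : C := (j%:R - i%:R).

Let gap_neq0 i j : i != j -> gap i j != 0.
Proof. by move=> ij; rewrite subr_eq0 eqr_nat eq_sym (inj_eq val_inj). Qed.

Let conj_gap i j : (gap i j)^* = gap i j.
Proof. by rewrite rmorphB /= !conjC_nat. Qed.

Let conj_B i j : (B i j)^* = B i j.
Proof.
by rewrite mxE; do 2?case: ifP => _; rewrite ?rmorphN ?rmorph1 ?rmorph0.
Qed.

Let X_gap i j : X i j * gap i j = B i j * W j j.
Proof.
have /matrixP/(_ i j) := e11.
rewrite [LHS]mxE mul_diag_mx mul_mx_diag (mulmx_diag_entryr _ Wdiag) !mxE /gap.
by rewrite -!natr1 => /eqP; rewrite addrC eq_sym -subr_eq => /eqP <-; ring.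
Qed.

Let Z_gap i j : Z i j * gap i j = - (B i j * W i i).
Proof.
have /matrixP/(_ i j) := e22.
rewrite [RHS]mxE mul_diag_mx mul_mx_diag (mulmx_diag_entryl _ Wdiag) !mxE /gap.
by rewrite -!natr1 => /eqP; rewrite -subr_eq => /eqP eqW; rewrite [_ * W i i]mulrC -eqW; ring.
Qed.

(** Compare [X_gap] at [(i, j)] with its conjugate at [(j, i)]: both [gap] and [B] are real and
    antisymmetric, so the two signs cancel. *)
Let W_conj i j : i != j -> W j j = (W i i)^*.
Proof.
move=> ij; apply: (mulfI (signB_neq0 ij)); rewrite -/B -X_gap hX.
rewrite -[gap i j]conj_gap -rmorphM /=.
have -> : X j i * gap i j = - (X j i * gap j i) by rewrite /gap; ring.
by rewrite X_gap rmorphN rmorphM /= conj_B {1}/B signB_anti mulNr opprK.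
Qed.

(** Conjugating twice through a third index [k] links any two diagonal entries. *)
Let W_const i j : W i i = W j j.
Proof.
have [k /andP[ki kj]] := third_ord i j (ltnW hd).
by rewrite (W_conj ki) (W_conj kj).
Qed.

(** [Y] is diagonal like its adjoint [W], so it commutes with [A] and drops out of [e12]. *)
Let BZ : B *m Z = X *m B.
Proof.
suff cAY : A *m Y = Y *m A.
  by apply: (addrI (A *m Y)); rewrite e12 cAY addrC.
apply/matrixP => i j; rewrite mul_diag_mx mul_mx_diag !mxE hYW.
have [->|ji] := eqVneq j i; first by rewrite mulrC.
by rewrite Wdiag // conjC0 mulr0 mul0r.
Qed.

Let W0 i : W i i = 0.
Proof.
(* Rows 0, 1 and columns 2, 3 are disjoint, so only off-diagonal entries of [X] and [Z], known in
   terms of [w], survive the differences. *)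
pose o0 : 'I_d := Ordinal (leq_trans (isT : (0 < 4)%N) hd).
pose o1 : 'I_d := Ordinal (leq_trans (isT : (1 < 4)%N) hd).
pose o2 : 'I_d := Ordinal (leq_trans (isT : (2 < 4)%N) hd).
pose o3 : 'I_d := Ordinal (leq_trans (isT : (3 < 4)%N) hd).
have comb (M : 'M[C]_d) : M = X *m B -> M o0 o2 - M o1 o2 - (M o0 o3 - M o1 o3) =
    - (X o0 o2 - X o1 o2) - (X o0 o3 - X o1 o3).
  move=> ->; rewrite !mxE -!sumrB.
  (* Antisymmetry of [B] turns its column difference into minus a row difference. *)
  transitivity (- \sum_k ((k == o2)%:R + (k == o3)%:R) * (X o0 k - X o1 k)).
    rewrite -sumrN; apply: eq_bigr => k _.
    rewrite -(signB_row_step (i := o2) (i' := o3)) //.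
    by rewrite (signB_anti k o2) (signB_anti k o3) /B; ring.
  by rewrite sum_pick2; ring.
have := comb _ BZ.
have -> : (B *m Z) o0 o2 - (B *m Z) o1 o2 - ((B *m Z) o0 o3 - (B *m Z) o1 o3) =
    (Z o0 o2 - Z o0 o3) + (Z o1 o2 - Z o1 o3).
  rewrite !mxE -!sumrB.
  transitivity (\sum_k ((k == o0)%:R + (k == o1)%:R) * (Z k o2 - Z k o3)).
    apply: eq_bigr => k _.
    rewrite -(signB_row_step (i := o0) (i' := o1)) // /B; ring.
  by rewrite sum_pick2; ring.
have XE (a b : 'I_d) : (a < b)%N -> X a b = W i i / gap a b.
  move=> ab; have gap0 : gap a b != 0.
    by apply: gap_neq0; rewrite -val_eqE /= ltn_eqF.
  apply: (mulIf gap0); rewrite X_gap /B signB_lt // mul1r divfK //.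
have ZE (a b : 'I_d) : (a < b)%N -> Z a b = - (W i i / gap a b).
  move=> ab; have gap0 : gap a b != 0.
    by apply: gap_neq0; rewrite -val_eqE /= ltn_eqF.
  apply: (mulIf gap0); rewrite Z_gap /B signB_lt // mul1r mulNr divfK //.
  by rewrite (W_const a i).
rewrite !ZE // !XE // /gap /=.
move=> eqW; have /eqP : W i i * 4 = 0.
  move/eqP: eqW; rewrite -subr_eq0 => /eqP eqW.
  (* The two sides are [-2w/3] and [2w/3]; multiplying their difference by [-3] gives [4w]. *)
  rewrite -[LHS]opprK -[RHS](mulr0 (-3)) -{}eqW.
  by field.
by rewrite mulf_eq0 pnatr_eq0 orbF => /eqP.
Qed.

Lemma block_commutant_scalar : exists x, block_mx X Y W Z = x%:M.
Proof.
have W00 : W = 0.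
  apply/matrixP => i j; rewrite !mxE.
  by have [->|ij] := eqVneq i j; [exact: W0 | exact: Wdiag].
have Y00 : Y = 0 by apply/matrixP => i j; rewrite hYW W00 !mxE conjC0.
have X0 i j : i != j -> X i j = 0.
  by move=> ij; apply: (mulIf (gap_neq0 ij)); rewrite X_gap W0 mulr0 mul0r.
have Z0 i j : i != j -> Z i j = 0.
  by move=> ij; apply: (mulIf (gap_neq0 ij)); rewrite Z_gap W0 mulr0 mul0r oppr0.
(* With [X] and [Z] now diagonal, each entry of [BZ] off the diagonal has the nonzero factor [B i j]
   on both sides. *)
have XZ i j : i != j -> Z j j = X i i.
  move=> ij; apply: (mulfI (signB_neq0 ij)); rewrite -/B.
  rewrite -(mulmx_diag_entryr _ Z0) BZ (mulmx_diag_entryl _ X0).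
  by rewrite mulrC.
pose o : 'I_d := Ordinal (leq_trans (isT : (0 < 4)%N) hd).
have Xo i : X i i = X o o.
  have [k /andP[ki ko]] := third_ord i o (ltnW hd).
  by rewrite -(XZ i k) 1?eq_sym // (XZ o k) // eq_sym.
have Zo i : Z i i = X o o.
  by have [k /andP[ki _]] := third_ord i i (ltnW hd); rewrite (XZ k).
exists (X o o); rewrite scalar_mx_block W00 Y00; congr block_mx.
- apply/matrixP => i j; rewrite mxE; have [->|ij] := eqVneq i j.
    by rewrite Xo.
  by rewrite X0.
- apply/matrixP => i j; rewrite mxE; have [->|ij] := eqVneq i j.
    by rewrite Zo.
  by rewrite Z0.
Qed.

End HermitianCommutant.

Lemma hermitian_commutant_scalar d (hd : (4 <= d)%N) (P : 'M[C]_(d + d)) :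
  let T := block_mx (diagA C d) (signB C d) 0 (diagA C d) in
  P^t* = P -> T *m P = P *m T -> exists x, P = x%:M.
Proof.
move=> T hP; rewrite -[P]submxK !mulmx_block !mul0mx !mulmx0 !addr0 !add0r.
have hPij i j : P i j = (P j i)^* by rewrite -[in LHS]hP !mxE.
move=> /eq_block_mx[e11 e12 e21 e22].
apply: (block_commutant_scalar hd) => // i j; rewrite !mxE; exact: hPij.
Qed.

(** The witness is the orthogonal projection onto the first summand; it is not scalar because both
    summands are nonzero. Keeping [n] and [e] general lets the cast be eliminated by case analysis
    on [e]. *)
Lemma direct_sum_commutant k m n (e : (k + m = n)%N) (A1 : 'M[C]_k)
    (A2 : 'M[C]_m) : (0 < k)%N -> (0 < m)%N ->
  let S := castmx (e, e) (block_mx A1 0 0 A2) in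
  exists E : 'M[C]_n,
    [/\ E^t* = E, S *m E = E *m S & forall x, E <> x%:M].
Proof.
case: n / e => k0 m0 /=; rewrite castmx_id.
exists (block_mx 1%:M 0 0 0); split.
- by rewrite tr_block_mx map_block_mx trmx1 !trmx0 map_mx1 !map_mx0.
- by rewrite !mulmx_block !(mul0mx, mulmx0, mulmx1, mul1mx, addr0).
- move=> x; rewrite scalar_mx_block => /eq_block_mx[e1 _ _ e0].
  move/matrixP/(_ (Ordinal k0) (Ordinal k0)): e1.
  move/matrixP/(_ (Ordinal m0) (Ordinal m0)): e0.
  by rewrite !mxE !eqxx !mulr1n => <- /eqP; rewrite oner_eq0.
Qed.

(** Conjugation by [U] carries the projection commuting with the direct sum to a Hermitian matrix
    commuting with [T]; were that scalar, undoing the conjugation would make the projection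
    scalar. *)
Lemma irreducible_of_commutant n (T : 'M[C]_n) :
  (forall P : 'M[C]_n, P^t* = P -> T *m P = P *m T -> exists x, P = x%:M) ->
  irreducible_mx T.
Proof.
move=> scal [k [k0 [kn [A1 [A2 [U unitU defT]]]]]].
have [E [hE cE nE]] : exists E : 'M[C]_n, [/\ E^t* = E,
    direct_sum_mx (ltnW kn) A1 A2 *m E = E *m direct_sum_mx (ltnW kn) A1 A2
    & forall x, E <> x%:M].
  by apply: direct_sum_commutant; rewrite ?subn_gt0.
have UU : U^t* *m U = 1%:M by apply: mulmx1C; apply/unitarymxP.
have [||x defP] := scal (U *m E *m U^t*).
- by rewrite !trmx_mul !map_mxM /= trmxCK hE mulmxA.
- by rewrite defT !mulmxA !mulmxKtV // -!(mulmxA U) cE.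
- apply: (nE x); have -> : E = U^t* *m (U *m E *m U^t*) *m U.
    by rewrite -!mulmxA UU mulmx1 mulmxA UU mul1mx.
  by rewrite defP mul_mx_scalar -scalemxAl UU scalemx1.
Qed.

End Blocks.

Local Open Scope complex_scope.

Theorem proposition7p1 (R : realType) (d : nat) (hd : (4 <= d)%N) :
  let A : 'M[R[i]]_d := diagA R[i] d in
  let B : 'M[R[i]]_d := signB R[i] d in
  let T : 'M[R[i]]_(d + d) := block_mx A B 0 A in
  skew_hamiltonian T /\ irreducible_mx T.
Proof.
move=> A B T; split.
  exists A, B, 0; split; first by rewrite /A tr_diag_mx.
    exact: signB_tr.
  by rewrite trmx0 oppr0.
by apply: irreducible_of_commutant => P; apply: hermitian_commutant_scalar.
Qed.
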